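(* Let $\mathbb{X},\mathbb{Y}$ be Banach spaces, $g:\mathbb{X}\to\mathbb{Y}$ continuously differentiable and $f:\mathbb{Y}\to\mathbb{R}$ convex and continuous. Let $S_f:=\{y:f(y)\le0\}$, $\mathcal{S}:=\{x:f(g(x))\le0\}$, and let $\bar x\in\mathcal{S}$ be such that $g$ is metrically regular around $\bar x$. Then the inequality $(f\circ g)(x)\le0$ has a local error bound at $\bar x$ if and only if $$\limsup_{x\xrightarrow{{\rm bd}(\mathcal{S})}\bar x}\mathbf{e}\Big(\{h\in\mathbb{X}:\mathbf{d}^+f(g(x),\nabla g(x)(h))\le1\},\ \nabla g(x)^{-1}\big(\mathbf{T}^{\mathbf B}(S_f,g(x))\big)\Big)<+\infty,$$ and moreover $\tau(\mathcal{S},\bar x)$ equals this $\limsup$.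
   Context: $\mathbf{B}(a,\delta)$ is the open ball with center $a$ and radius $\delta$; ${\rm bd}$ denotes boundary; $\mathbf{d}(x,D):=\inf\{\|x-y\|:y\in D\}$. Excess: $\mathbf{e}(C,D):=\sup_{x\in C}\mathbf{d}(x,D)$, with $\mathbf{e}(\emptyset,D)=0$ if $D\ne\emptyset$ and $=\infty$ otherwise. For convex $f$, $\mathbf{d}^+f(y,v):=\lim_{t\to0^+}\frac{f(y+tv)-f(y)}{t}$. Bouligand tangent cone $\mathbf{T}^{\mathbf B}(C,c)$: all $v$ with $v_n\to v$, $t_n\downarrow0$, $c+t_nv_n\in C$. ''Continuously differentiable'' means Fréchet differentiable with $x\mapsto\nabla g(x)$ continuous in operator norm. $g$ is metrically regular around $\bar x$ if there exist $\kappa>0$ and neighborhoods $U$ of $\bar x$, $V$ of $g(\bar x)$ with $\mathbf{d}(x,g^{-1}(y))\le\kappa\|g(x)-y\|$ for all $(x,y)\in U\times V$. Local error bound at $\bar x$: there exist $\tau,\delta>0$ with $\mathbf{d}(x,\mathcal{S})\le\tau\max\{f(g(x)),0\}$ for all $x\in\mathbf{B}(\bar x,\delta)$; $\tau(\mathcal{S},\bar x)$ is the infimum of all such $\tau$ (with $\inf\emptyset=+\infty$). $\limsup_{x\xrightarrow{D}\bar x}F(x):=\lim_{\delta\downarrow0}\sup\{F(x):x\in D\cap\mathbf{B}(\bar x,\delta)\}$, with the convention $\sup\emptyset=0$. *)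

(* Defs.v *)
From HB Require Import structures.
From mathcomp Require Import all_boot all_order all_algebra.
From mathcomp Require Import all_classical all_reals all_analysis.
Set Implicit Arguments. Unset Strict Implicit. Unset Printing Implicit Defensive.
Import Order.TTheory GRing.Theory Num.Theory.
Import numFieldNormedType.Exports.
Local Open Scope classical_set_scope.
Local Open Scope ring_scope.

Section Defs.
Variable R : realType.

(* d(x, D) := inf { ||x - y|| : y in D }  (= +oo when D is empty) *)
Definition dist_set {V : normedModType R} (x : V) (D : set V) : \bar R :=
  ereal_inf [set (`|x - y|)%:E | y in D].

Definition excess {V : normedModType R} (C D : set V) : \bar R :=
  if `[< C = set0 >] then (if `[< D = set0 >] then +oo%E else 0%E)
  else ereal_sup [set dist_set x D | x in C].

Definition dir_deriv {V : normedModType R} (f : V -> R) (y v : V) : R :=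
  lim ((fun t : R => (f (y + t *: v) - f y) / t) @ 0^'+).

Definition bouligand {V : normedModType R} (C : set V) (c : V) : set V :=
  [set v | exists (vs : nat -> V) (ts : nat -> R),
      vs @ \oo --> v /\ ts @ \oo --> 0 /\ (forall n, 0 < ts n) /\
      (forall n, C (c + ts n *: vs n))].

Definition bd {T : topologicalType} (A : set T) : set T := closure A `\` interior A.

Definition sup0 (A : set (\bar R)) : \bar R :=
  if `[< A = set0 >] then 0%E else ereal_sup A.

Definition limsup_within {V : normedModType R} (D : set V) (xbar : V)
    (F : V -> \bar R) : \bar R :=
  lim ((fun delta : R => sup0 (F @` (D `&` ball xbar delta))) @ 0^'+).

Definition convex_fun {V : normedModType R} (f : V -> R) : Prop :=
  forall y1 y2 (l : R), 0 <= l -> l <= 1 ->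
    f (l *: y1 + (1 - l) *: y2) <= l * f y1 + (1 - l) * f y2.

(* Frechet differentiable everywhere, with x |-> 'd g x continuous in operator norm
   (written out: ||'d g x' - 'd g x||_op <= eps for x' near x). *)
Definition cont_diff {X Y : normedModType R} (g : X -> Y) : Prop :=
  (forall x, differentiable g x) /\
  (forall x (eps : R), 0 < eps -> exists delta : R, 0 < delta /\
     forall x', `|x' - x| < delta -> forall h, `|'d g x' h - 'd g x h| <= eps * `|h|).

Definition metrically_regular {X Y : normedModType R} (g : X -> Y) (xbar : X) : Prop :=
  exists kappa : R, 0 < kappa /\
  exists (U : set X) (W : set Y), nbhs xbar U /\ nbhs (g xbar) W /\
    forall x y, U x -> W y ->
      (dist_set x (g @^-1` [set y]) <= (kappa * `|g x - y|)%:E)%E.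

Definition eb_consts {X Y : normedModType R} (f : Y -> R) (g : X -> Y) (xbar : X) : set R :=
  [set tau : R | (0 < tau)%R /\ exists delta : R, 0 < delta /\
     forall x, ball xbar delta x ->
       (dist_set x [set z | (f (g z) <= 0)%R] <= (tau * Num.max (f (g x)) 0)%:E)%E].

Definition local_error_bound {X Y : normedModType R} (f : Y -> R) (g : X -> Y) (xbar : X) : Prop :=
  exists tau, eb_consts f g xbar tau.

(* tau(S, xbar) = inf of admissible tau (inf set0 = +oo) *)
Definition eb_modulus {X Y : normedModType R} (f : Y -> R) (g : X -> Y) (xbar : X) : \bar R :=
  ereal_inf [set tau%:E | tau in eb_consts f g xbar].

End Defs.

(* Main.v *)
(** Lower bound on the modulus: if [f (g x) = 0] and [h] has slope at most 1, the
    error bound at [x + t h] gives [z] in S with [(z - x) / t] within about [tau]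
    of [h]; convexity makes [(g z - g x) / t] tangent to [Sf], and surjectivity
    of ['d g x] (from metric regularity) corrects the first-order error.

    Upper bound: for [x] outside S, Ekeland's principle applied to [|x - .|] on S
    yields a boundary point [u] that is almost a projection of [x]. By metric
    regularity S is approximated near [u] by [u + 'd g u^-1 (T (Sf, g u))], so
    [|x - u|] is almost the distance from [x - u] to that cone, which the excess
    bounds by a multiple of the slope of [f o g] along [x - u]; strict
    differentiability and convexity bound the slope by [f (g x)], up to an error
    that is small compared with [|x - u|]. *)
Require Import Defs.
From HB Require Import structures.
From mathcomp Require Import all_boot all_order all_algebra.
From mathcomp Require Import all_classical all_reals all_analysis.
From mathcomp Require Import lra ring.
Import Order.TTheory GRing.Theory Num.Theory.
Import numFieldNormedType.Exports.
Local Open Scope classical_set_scope.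
Local Open Scope ring_scope.

(** * Ekeland's variational principle *)

(** Starting from [x0], each new point nearly minimises [phi] over the points below the current one
    in the order encoded by [T]. Completeness gives a limit, below which no point has a smaller
    value of [phi]. *)
Lemma ekeland (R : realType) (V : completeNormedModType R) (A : set V)
    (phi : V -> R) (eta m : R) (x0 : V) :
  closed A -> continuous phi -> 0 < eta -> (forall z, A z -> m <= phi z) ->
  A x0 ->
  exists u, [/\ A u, phi u + eta * `|u - x0| <= phi x0 &
    forall z, A z -> phi u <= phi z + eta * `|z - u|].
Proof.
move=> clA cphi eta0 phim Ax0.
pose T y := [set z | A z /\ phi z + eta * `|z - y| <= phi y].
have Trefl y : A y -> T y y by move=> Ay; split=> //; rewrite subrr normr0; lra.
have Ttrans y z w : T y z -> T z w -> T y w.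
  move=> [Az yz] [Aw zw]; split=> //.
  have := ler_distD z w y; rewrite -(ler_pM2l eta0) mulrDr; lra.
have step (p : nat * V) : exists z, A p.2 ->
    T p.2 z /\ forall w, T p.2 w -> phi z <= phi w + p.1.+1%:R^-1.
  case: p => n y /=; have [Ay|nAy] := pselect (A y); last by exists y.
  have lb : has_lbound (phi @` T y) by exists m => _ [z [Az _] <-]; exact: phim.
  have hi : has_inf (phi @` T y).
    by split=> //; exists (phi y); exists y => //; exact: Trefl.
  have n0 : 0 < n.+1%:R^-1 :> R by rewrite invr_gt0 ltr0n.
  have [_ [z Tz <-] zlt] := inf_adherent n0 hi.
  exists z => _; split=> // w Tw.
  apply: (le_trans (ltW zlt)); rewrite lerD2r.
  by apply: ge_inf => //; exists w.
have [s hs] := choice step.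
pose y_ n := iteri n (fun k z => s (k, z)) x0.
have Ay n : A (y_ n).
  by elim: n => [//|n IH]; have [[]] := hs (n, y_ n) IH.
have TyS n : T (y_ n) (y_ n.+1) by have [] := hs (n, y_ n) (Ay n).
have Ty n k : (n <= k)%N -> T (y_ n) (y_ k).
  elim: k => [|k IH]; first by rewrite leqn0 => /eqP->; exact: Trefl.
  rewrite leq_eqVlt => /predU1P[->|]; first exact: Trefl.
  by rewrite ltnS => /IH/Ttrans; apply.
have phiT y z : T y z -> phi z <= phi y.
  by move=> [_]; have := mulr_ge0 (ltW eta0) (normr_ge0 (z - y)); lra.
have lbp : has_lbound (range (phi \o y_)).
  by exists m => _ [n _ <-]; exact: phim.
have infle n : inf (range (phi \o y_)) <= phi (y_ n).
  by apply: ge_inf => //; exists n.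
(* [phi] is nonincreasing along [y_] and bounded below, and [eta] times the distance between two
   terms is at most the drop of [phi] between them. *)
have cvy : cvg (y_ @ \oo).
  apply/cauchy_cvgP/cauchy_exP => e e0.
  have hi : has_inf (range (phi \o y_)) by split=> //; exists (phi (y_ 0)); exists 0%N.
  have [_ [n _ <-] /= nlt] := @inf_adherent _ _ (eta * e) (mulr_gt0 eta0 e0) hi.
  exists (y_ n); exists n => // k /= nk.
  rewrite -ball_normE /ball_/= distrC -(ltr_pM2l eta0).
  have [_] := Ty _ _ nk; have := infle k; lra.
have clT y : closed (T y).
  apply: closedI => //.
  apply: (@closed_comp _ _ (fun z => phi z + eta * `|z - y|) [set r | r <= phi y]).
    move=> z _; apply: cvgD; first exact: cphi.
    apply: cvgM; first exact: cvg_cst.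
    by apply: cvg_norm; apply: cvgB; [exact: cvg_id|exact: cvg_cst].
  exact: closed_le.
have Tyu n : T (y_ n) (lim (y_ @ \oo)).
  apply: (closed_cvg _ (clT _) _ _ cvy).
  by exists n => // k /= nk; exact: Ty.
set u := lim _ in Tyu.
exists u; split; first by have [] := Tyu 0%N.
  by have [] := Tyu 0%N.
(* In the remaining case [z] lies in [T u], hence in every [T (y_ n)]. The near-minimality of
   [y_ n.+1] then gives [phi u <= phi z] up to [1 / (n + 1)], for every [n]. *)
move=> z Az; have [zu|/ltW//] := leP (phi z + eta * `|z - u|) (phi u).
have Tuz : T u z by [].
suff : phi u <= phi z by have := mulr_ge0 (ltW eta0) (normr_ge0 (z - u)); lra.
apply/ler_addgt0Pr => e e0.
have [n _ /(_ n (leqnn n)) /= ne] := near_infty_natSinv_lt (PosNum e0).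
have [_ /(_ z (Ttrans _ _ _ (Tyu n) Tuz))] := hs (n, y_ n) (Ay n).
have := phiT _ _ (Tyu n.+1); rewrite /= in ne * => h1 h2.
by apply: (le_trans h1); apply: (le_trans h2); rewrite lerD2l ltW.
Qed.

(** * Strict differentiability, and surjectivity of linear maps *)

Lemma differentiable_expansion (R : realType) (V W : normedModType R)
    (g : V -> W) (x : V) (eps : R) :
  differentiable g x -> 0 < eps ->
  exists2 d : R, 0 < d & forall h, `|h| < d ->
    `|g (x + h) - g x - 'd g x h| <= eps * `|h|.
Proof.
move=> dg eps0.
have /eqaddoP/(_ eps eps0)/nbhs_normP[d d0 Hd] := diff_locally dg.
exists d => // h hd.
have /= := Hd h ltac:(by rewrite /ball_ /= sub0r normrN).
by rewrite /= opprD !fctE /= addrA (addrC h).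
Qed.

(* Ekeland applied to [s |-> - s] on the closed set of [s] in [0, 1] for which
   the bound holds at [u + s (x - u)]; a minimiser [s < 1] could be increased. *)
Lemma strictly_differentiable (R : realType) (V W : normedModType R)
    (g : V -> W) (xbar : V) (eps : R) :
  cont_diff g -> 0 < eps ->
  exists2 d : R, 0 < d & forall u x, `|u - xbar| < d -> `|x - xbar| < d ->
    `|g x - g u - 'd g u (x - u)| <= eps * `|x - u|.
Proof.
move=> [dg cdg] eps0.
have e30 : 0 < eps / 3 by lra.
have [d [d0 Hd]] := cdg xbar _ e30.
exists d => // u x ud xd.
pose k := x - u.
pose A : set R := [set s | (0 <= s /\ s <= 1) /\
   `|g (u + s *: k) - g u - s *: 'd g u k| - eps * `|k| * s <= 0].
have cg : continuous g by move=> z; exact: differentiable_continuous.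
have clA : closed A.
  apply: closedI.
    by apply: closedI; [exact: closed_ge|exact: closed_le].
  apply: (@closed_comp _ _ (fun s : R =>
     `|g (u + s *: k) - g u - s *: 'd g u k| - eps * `|k| * s) [set r | r <= 0]);
    last exact: closed_le.
  move=> s _; apply: cvgB; last by apply: cvgM; [exact: cvg_cst|exact: cvg_id].
  apply: cvg_norm; apply: cvgB; last by apply: cvgZr_tmp; exact: cvg_id.
  apply: cvgB; last exact: cvg_cst.
  apply: (@cvg_comp _ _ _ (fun s : R => u + s *: k) g); last exact: cg.
  by apply: cvgD; [exact: cvg_cst|apply: cvgZr_tmp; exact: cvg_id].
have A0 : A 0.
  by split; [split=> //|]; rewrite ?scale0r addr0 subrr subr0 normr0 mulr0 subr0.
(* With weight 1/2, minimality forbids [s + t] in [A] for [t > 0], since it would give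
   [t <= t / 2]. *)
have [||//|s [[[s0 s1] As] _ smax]] :=
  @ekeland R R A (fun s => - s) 2^-1 (-1) 0 clA _ _ _ A0.
- by move=> s; apply: cvgN; exact: cvg_id.
- by rewrite invr_gt0.
- by move=> z [[_ z1] _]; rewrite lerN2.
have [s1'|s1'] := eqVneq s 1.
  by move: As; rewrite s1' !scale1r mulr1 /k (addrC u) subrK subr_le0.
have {s1'}s1 : s < 1 by rewrite lt_neqAle s1'.
pose p := u + s *: k.
have pd : `|p - xbar| < d.
  have -> : p - xbar = s *: (x - xbar) + (1 - s) *: (u - xbar).
    have -> : x - xbar = k + (u - xbar) by rewrite addrA subrK.
    by rewrite scalerDr scalerBl scale1r [RHS]addrC (addrC (s *: k)) subrKA /p addrAC.
  apply: (le_lt_trans (ler_normD _ _)); rewrite !normrZ.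
  rewrite (ger0_norm s0) ger0_norm ?subr_ge0 ?(ltW s1)//.
  nra.
have [r r0 Hr] := differentiable_expansion _ _ _ _ _ _ (dg p) e30.
pose t := Num.min (1 - s) (r / (2 * (`|k| + 1))).
have k1 : 0 < `|k| + 1 by rewrite ltr_wpDl.
have t0 : 0 < t by rewrite lt_min subr_gt0 s1 divr_gt0// mulr_gt0.
have : A (s + t).
  have tle : t <= 1 - s by rewrite ge_min lexx.
  split; first by split; lra.
  have tk : `|t *: k| = t * `|k| by rewrite normrZ gtr0_norm.
  have tr : `|t *: k| < r.
    have := ge_min (r / (2 * (`|k| + 1))) (1 - s) (r / (2 * (`|k| + 1))).
    rewrite lexx orbT -/t ler_pdivlMr ?mulr_gt0// tk => h.
    have := normr_ge0 k; nra.
  have := Hr _ tr; rewrite tk linearZ/= => hr.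
  have hp := Hd _ pd k; have hu := Hd _ ud k.
  (* The error at [s + t] is the expansion error at [p], plus the error at [s], plus [t] times the
     change of derivative from [u] to [p]. The change is measured through [xbar], so the growth
     consists of three terms of size at most [t * eps / 3 * |k|]. *)
  have -> : g (u + (s + t) *: k) - g u - (s + t) *: 'd g u k =
     (g (p + t *: k) - g p - t *: 'd g p k) + (g p - g u - s *: 'd g u k) +
     t *: (('d g p k - 'd g xbar k) - ('d g u k - 'd g xbar k)).
    have -> : u + (s + t) *: k = p + t *: k by rewrite scalerDl addrA.
    rewrite opprB subrKA (scalerBr t ('d g p k)) scalerDl [RHS]addrAC subrKA.
    by rewrite addrACA subrKA -opprD (addrC (t *: _)).
  have := ler_normD
    ((g (p + t *: k) - g p - t *: 'd g p k) + (g p - g u - s *: 'd g u k))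
    (t *: (('d g p k - 'd g xbar k) - ('d g u k - 'd g xbar k))).
  have := ler_normD (g (p + t *: k) - g p - t *: 'd g p k) (g p - g u - s *: 'd g u k).
  have := ler_normB ('d g p k - 'd g xbar k) ('d g u k - 'd g xbar k).
  rewrite normrZ (gtr0_norm t0); rewrite -/p in As; nra.
move=> /smax; rewrite (addrC s) addrK ger0_norm ?(ltW t0)//; lra.
Qed.

(* Ekeland applied to [h |-> |A h - v|]: at the approximate minimiser the
   residual must vanish, since correcting it would decrease the norm by half. *)
Lemma almost_open_onto (R : realType) (V : completeNormedModType R)
    (W : normedModType R) (A : {linear V -> W}) (K : R) :
  continuous A -> 0 < K ->
  (forall v, exists2 h, `|h| <= K * `|v| & `|A h - v| <= `|v| / 2) ->
  forall v, exists2 h, `|h| <= 4 * K * `|v| & A h = v.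
Proof.
move=> cA K0 HA v.
(* With this weight a correction of norm at most [K * |v - A u|] costs a quarter of the residual,
   while it gains at least half of it. *)
have eta0 : 0 < (4 * K)^-1 by rewrite invr_gt0 mulr_gt0.
have [|//|u [_ ule umin]] := @ekeland R V setT (fun h => `|A h - v|) (4 * K)^-1 0 0
  closedT _ eta0 _ I.
- move=> h; apply: cvg_norm; apply: cvgB; last exact: cvg_cst.
  exact: cA.
exists u.
  move: ule; rewrite (linear0 A) sub0r normrN subr0 => ule.
  rewrite -ler_pdivrMl ?mulr_gt0//; have := normr_ge0 (A u - v); lra.
have [e eK Ae] := HA (v - A u).
have := umin (u + e) I; rewrite (addrC u) addrK linearD/= -addrA.
have -> : A e + (A u - v) = A e - (v - A u) by rewrite opprB.
have -> : `|A u - v| = `|v - A u| by rewrite distrC.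
move=> h.
have : (4 * K)^-1 * `|e| <= `|v - A u| / 4.
  rewrite ler_pdivrMl ?mulr_gt0//; lra.
move=> h'; have : `|v - A u| <= 0 by lra.
by rewrite normr_le0 subr_eq0 => /eqP.
Qed.

(** * Metric regularity and surjectivity of the derivative *)

(** The infimum in [dist_set] need not be attained, hence the strict bound by [theta]. Half of the
    radius around [g xbar] is spent on moving from [g xbar] to [g x], so that [y] can be localised
    around [g x]. *)
Lemma metrically_regularP (R : realType) (X Y : normedModType R)
    (g : X -> Y) (xbar : X) :
  continuous g -> metrically_regular g xbar ->
  exists kappa rho : R, [/\ 0 < kappa, 0 < rho & forall x y,
    `|x - xbar| < rho -> `|y - g x| < rho ->
    forall theta, kappa * `|g x - y| < theta ->
    exists2 z, g z = y & `|x - z| < theta].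
Proof.
move=> cg [kappa [k0 [U [W [nU [nW H]]]]]].
have [r1 /= r10 HU] := (nbhs_normP _ _).1 nU.
have [r2 /= r20 HW] := (nbhs_normP _ _).1 nW.
have r220 : 0 < r2 / 2 by lra.
have [r3 /= r30 Hg] := (nbhs_normP _ _).1 (cvgr_dist_lt _ _ (cg xbar) _ r220).
exists kappa, (Num.min r1 (Num.min (r2 / 2) r3)); split=> //.
  by rewrite !lt_min r10 r220.
move=> x y; rewrite !lt_min => /and3P[x1 x2 x3] /and3P[y1 y2 y3] theta hth.
have Ux : U x by apply: HU; rewrite /ball_/= distrC.
have Wy : W y.
  apply: HW; rewrite /ball_/=.
  have := Hg x; rewrite /ball_/= distrC => /(_ x3) hg.
  have := ler_distD (g x) (g xbar) y; rewrite (distrC (g x) y); lra.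
have /le_lt_trans/(_ (_ : _ < theta%:E)%E) := H x y Ux Wy.
rewrite lte_fin => /(_ hth) /ereal_inf_lt[_ [z gz <-]]; rewrite lte_fin => h.
by exists z.
Qed.

(** For small [t], solving [g z = g x + t v] with [z] near [x] and linearising makes [(z - x) / t] a
    preimage of [v] up to an error [|v| / 2]. This is the hypothesis of [almost_open_onto]. The
    constant [kappa + 1] leaves room for the strict bound. *)
Lemma metrically_regular_onto (R : realType) (X : completeNormedModType R)
    (Y : normedModType R) (g : X -> Y) (x : X) (kappa rho : R) :
  differentiable g x -> 0 < kappa -> 0 < rho ->
  (forall y, `|y - g x| < rho -> forall theta, kappa * `|g x - y| < theta ->
    exists2 z, g z = y & `|x - z| < theta) ->
  forall v, exists2 h, `|h| <= 4 * (kappa + 1) * `|v| & 'd g x h = v.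
Proof.
move=> dg k0 r0 H; have K0 : 0 < kappa + 1 by lra.
apply: almost_open_onto => //; first exact: diff_continuous.
move=> v; have [->|vN0] := eqVneq v 0.
  by exists 0; rewrite ?subr0 ?linear0 !normr0 ?mulr0 ?mul0r.
have v0 : 0 < `|v| by rewrite normr_gt0.
have e0 : 0 < (2 * (kappa + 1))^-1 by rewrite invr_gt0 mulr_gt0.
have [d d0 Hd] := differentiable_expansion _ _ _ _ _ _ dg e0.
pose t := Num.min (rho / (2 * `|v|)) (d / ((kappa + 1) * `|v|)).
have t0 : 0 < t by rewrite lt_min !divr_gt0// mulr_gt0.
have trho : t <= rho / (2 * `|v|) by rewrite ge_min lexx.
have td : t <= d / ((kappa + 1) * `|v|) by rewrite ge_min lexx orbT.
rewrite ler_pdivlMr ?mulr_gt0// in trho; rewrite ler_pdivlMr ?mulr_gt0// in td.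
have tv : `|t *: v| = t * `|v| by rewrite normrZ gtr0_norm.
have tv0 : 0 < t * `|v| by rewrite mulr_gt0.
have [||z gz xz] := H (g x + t *: v) _ ((kappa + 1) * (t * `|v|)).
- rewrite (addrC (g x)) addrK tv; lra.
- rewrite opprD addrA subrr sub0r normrN tv; lra.
have zx : `|z - x| < d by rewrite distrC (lt_le_trans xz)//; lra.
have := Hd _ zx; rewrite (addrC x) subrK gz (addrC (g x)) addrK => hz.
exists (t^-1 *: (z - x)).
  by rewrite normrZ gtr0_norm ?invr_gt0// ler_pdivrMl// distrC ltW//; lra.
have -> : 'd g x (t^-1 *: (z - x)) - v = t^-1 *: ('d g x (z - x) - t *: v).
  by rewrite linearZ/= scalerBr scalerA mulVf ?gt_eqF// scale1r.
rewrite normrZ gtr0_norm ?invr_gt0// ler_pdivrMl// distrC.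
apply: (le_trans hz); rewrite ler_pdivrMl ?mulr_gt0// distrC.
apply: (le_trans (ltW xz)); lra.
Qed.

(** * Convex functions: Lipschitz bounds and directional derivatives *)

(** Prolonging the segment from [y] through [y'] by length [r / 2] stays in a ball where [f]
    oscillates by at most 2. Convexity on the prolonged segment turns this into a slope bound. *)
Lemma convex_locally_lipschitz (R : realType) (V : normedModType R)
    (f : V -> R) (y0 : V) :
  convex_fun f -> continuous f ->
  exists l r : R, [/\ 0 < l, 0 < r & forall y y', `|y - y0| < r ->
    `|y' - y0| < r -> f y' - f y <= l * `|y' - y|].
Proof.
move=> cf cont.
have [r /= r0 Hr] := (nbhs_normP _ _).1 (cvgr_dist_lt _ _ (cont y0) _ ltr01).
have r20 : 0 < r / 2 by lra.
exists (2 / (r / 2)), (r / 2); split=> //; first by rewrite divr_gt0.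
move=> y y' yr yr'.
have [->|yy'] := eqVneq y' y; first by rewrite !subrr normr0 mulr0.
set d := `|y' - y|; have d0 : 0 < d by rewrite normr_gt0 subr_eq0.
set p := r / 2 in r20 yr yr' *.
have pd0 : 0 < p + d by lra.
pose y2 := y' + (p / d) *: (y' - y).
have hy2 : `|f y0 - f y2| < 1.
  apply: Hr; rewrite /ball_/= distrC /y2 addrAC.
  apply: (le_lt_trans (ler_normD _ _)).
  rewrite normrZ -/d gtr0_norm ?divr_gt0// divfK ?gt_eqF//; rewrite /p in yr' *; lra.
have hy : `|f y0 - f y| < 1.
  by apply: Hr; rewrite /ball_/= distrC; rewrite /p in yr; lra.
have l1 : d / (p + d) <= 1 by rewrite ler_pdivrMr// mul1r; lra.
have l0 : 0 <= d / (p + d) by rewrite divr_ge0// ltW.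
have := cf y2 y _ l0 l1.
have -> : d / (p + d) *: y2 + (1 - d / (p + d)) *: y = y'.
  rewrite /y2 scalerDr scalerA.
  have -> : d / (p + d) * (p / d) = 1 - d / (p + d).
    by field; rewrite !gt_eqF.
  by rewrite -addrA -scalerDr subrK -scalerDl addrC subrK scale1r.
move=> h; have : f y' - f y <= d / (p + d) * (f y2 - f y) by lra.
move/le_trans; apply.
have : f y2 - f y <= 2 by move: hy hy2; rewrite !ltr_norml => /andP[? ?] /andP[? ?]; lra.
move=> /(ler_wpM2l l0)/le_trans; apply.
rewrite mulrC -!mulrA ler_pM2l// mulrC ler_pM2r// lef_pV2 ?posrE//; lra.
Qed.

Section directional_derivative.
Variables (R : realType) (V : normedModType R) (f : V -> R) (y v : V).
Hypothesis cf : convex_fun f.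

Lemma convex_ray_le (s t : R) : 0 <= s -> s <= t -> 0 < t ->
  f (y + s *: v) <= s / t * f (y + t *: v) + (1 - s / t) * f y.
Proof.
move=> s0 st t0.
have l1 : s / t <= 1 by rewrite ler_pdivrMr// mul1r.
have l0 : 0 <= s / t by rewrite divr_ge0// ltW.
have := cf (y + t *: v) y _ l0 l1.
suff -> : (s / t) *: (y + t *: v) + (1 - s / t) *: y = y + s *: v by [].
rewrite scalerDr scalerA divfK ?gt_eqF// addrAC.
by rewrite -[RHS](congr1 (+%R^~ _) (scale1r y)) -scalerDl subrKC.
Qed.

Lemma convex_slope_le (s t : R) : 0 < s -> s <= t ->
  (f (y + s *: v) - f y) / s <= (f (y + t *: v) - f y) / t.
Proof.
move=> s0 st; have t0 : 0 < t by lra.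
have := convex_ray_le _ _ (ltW s0) st t0.
by move=> h; rewrite ler_pdivrMr// mulrAC -mulrA; lra.
Qed.

(** [y] is a convex combination of [y - v] and [y + t v]. The bound does not depend on [t], so it
    bounds all slopes from below. *)
Lemma convex_slope_ge (t : R) : 0 < t ->
  f y - f (y - v) <= (f (y + t *: v) - f y) / t.
Proof.
move=> t0; have t10 : 0 < 1 + t by lra.
have l1 : (1 + t)^-1 <= 1 by rewrite invf_le1//; lra.
have l0 : 0 <= (1 + t)^-1 by rewrite invr_ge0 ltW.
have := cf (y + t *: v) (y - v) _ l0 l1.
have -> : 1 - (1 + t)^-1 = (1 + t)^-1 * t by field; rewrite gt_eqF.
have -> : (1 + t)^-1 *: (y + t *: v) + ((1 + t)^-1 * t) *: (y - v) = y.
  rewrite -scalerA -scalerDr scalerBr addrACA subrr addr0.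
  have -> : y + t *: y = (1 + t) *: y by rewrite scalerDl scale1r.
  by rewrite scalerA mulVf ?gt_eqF// scale1r.
rewrite -mulrA -mulrDr ler_pdivlMl// => h.
rewrite ler_pdivlMr//; lra.
Qed.

(** The slopes are monotone in [t] and bounded below, so the [lim] in [dir_deriv] is a genuine
    limit. *)
Lemma dir_deriv_cvg :
  (f (y + t *: v) - f y) / t @[t --> 0^'+] --> dir_deriv f y v.
Proof.
apply: (@nondecreasing_at_right_is_cvgr R).
  near=> x => s t; rewrite !in_itv/= => /andP[s0 _] /andP[t0 _].
  exact: convex_slope_le.
near=> x; exists (f y - f (y - v)) => _ [t + <-].
by rewrite /= in_itv/= => /andP[t0 _]; exact: convex_slope_ge.
Unshelve. all: by end_near. Qed.

Lemma dir_deriv_lt (c : R) : dir_deriv f y v < c ->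
  exists2 d : R, 0 < d & forall t, 0 < t -> t < d -> f (y + t *: v) - f y <= c * t.
Proof.
move=> /(cvgr_lt _ dir_deriv_cvg)[d /= d0 H].
exists d => // t t0 td; rewrite -ler_pdivrMr// ltW//; apply: H => //=.
by rewrite sub0r normrN gtr0_norm.
Qed.

Lemma dir_deriv_le (c d : R) : 0 < d ->
  (forall t, 0 < t -> t < d -> f (y + t *: v) - f y <= c * t) ->
  dir_deriv f y v <= c.
Proof.
move=> d0 H; apply: limr_le; first exact: dir_deriv_cvg.
exists d => // t /=; rewrite sub0r normrN => td t0.
by rewrite ler_pdivrMr// H// -(gtr0_norm t0).
Qed.

End directional_derivative.

(** * Distance, excess and limit superior *)

Lemma dist_set_ge0 (R : realType) (V : normedModType R) (x : V) (D : set V) :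
  (0 <= dist_set x D)%E.
Proof. by apply: le_ereal_inf_tmp => _ [z _ <-]; rewrite lee_fin. Qed.

Lemma dist_set_le (R : realType) (V : normedModType R) (x z : V) (D : set V) :
  D z -> (dist_set x D <= `|x - z|%:E)%E.
Proof. by move=> Dz; apply: ereal_inf_lbound; exists z. Qed.

Lemma dist_set_lt (R : realType) (V : normedModType R) (x : V) (D : set V)
    (r : R) :
  (dist_set x D < r%:E)%E -> exists2 z, D z & `|x - z| < r.
Proof. by move=> /ereal_inf_lt[_ [z Dz <-]]; rewrite lte_fin; exists z. Qed.

Lemma excess_ge0 (R : realType) (V : normedModType R) (C D : set V) :
  (0 <= excess C D)%E.
Proof.
rewrite /excess; case: asboolP => [_|]; first by case: asboolP.
move=> /eqP/set0P[x Cx]; apply: (le_trans (dist_set_ge0 _ _ x D)).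
by apply: ereal_sup_ubound; exists x.
Qed.

Lemma dist_set_le_excess (R : realType) (V : normedModType R) (C D : set V) x :
  C x -> (dist_set x D <= excess C D)%E.
Proof.
move=> Cx; rewrite /excess; case: asboolP => [C0|_]; first by rewrite C0 in Cx.
by apply: ereal_sup_ubound; exists x.
Qed.

(** Nonemptiness of [C] rules out the case of two empty sets, where the excess is [+oo]. *)
Lemma excess_le (R : realType) (V : normedModType R) (C D : set V) (c : \bar R) :
  C !=set0 -> (forall x, C x -> (dist_set x D <= c)%E) -> (excess C D <= c)%E.
Proof.
move=> /set0P/eqP C0 H; rewrite /excess; case: asboolP => // _.
by apply: ge_ereal_sup => _ [x Cx <-]; exact: H.
Qed.

Section limsup_within_theory.
Variables (R : realType) (V : normedModType R) (D : set V) (xbar : V).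
Variable F : V -> \bar R.
Hypothesis F0 : forall x, (0 <= F x)%E.

Let s (delta : R) := Defs.sup0 (F @` (D `&` ball xbar delta)).

(** The sign condition on [c] accounts for the value 0 of [sup0] on the empty set. *)
Let sP delta c : (0 <= c)%E ->
  (s delta <= c)%E <-> forall x, D x -> ball xbar delta x -> (F x <= c)%E.
Proof.
move=> c0; rewrite /s /Defs.sup0; case: asboolP => [e|_]; split=> //.
- move=> _ x Dx bx; have : (F @` (D `&` ball xbar delta)) (F x) by exists x.
  by rewrite e.
- move=> h x Dx bx; apply: le_trans h.
  by apply: ereal_sup_ubound; exists x.
- by move=> h; apply: ge_ereal_sup => _ [x [Dx bx] <-]; exact: h.
Qed.

Let s_ge0 delta : (0 <= s delta)%E.
Proof.
rewrite /s /Defs.sup0; case: asboolP => // /eqP/set0P[_ [x Dx _]].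
by apply: (le_trans (F0 x)); apply: ereal_sup_ubound; exists x.
Qed.

Lemma limsup_within_cvg : s delta @[delta --> 0^'+] --> limsup_within D xbar F.
Proof.
apply: nondecreasing_at_right_is_cvge; near=> d => a b _ _ ab.
apply/sP => // x Dx bx; move: (lexx (s b)) => /(sP _ _ (s_ge0 b)); apply => //.
exact: le_ball bx.
Unshelve. all: by end_near. Qed.

Lemma limsup_within_ge0 : (0 <= limsup_within D xbar F)%E.
Proof.
apply: lime_ge; first exact: limsup_within_cvg.
by near=> d; exact: s_ge0.
Unshelve. all: by end_near. Qed.

Lemma limsup_within_le (c : \bar R) (delta : R) : 0 < delta -> (0 <= c)%E ->
  (forall x, D x -> ball xbar delta x -> (F x <= c)%E) ->
  (limsup_within D xbar F <= c)%E.
Proof.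
move=> d0 c0 H; apply: lime_le; first exact: limsup_within_cvg.
near=> d; apply/sP => // x Dx bx; apply: H => //.
apply: le_ball bx; near: d; exact: nbhs_right_le.
Unshelve. all: by end_near. Qed.

Lemma limsup_within_lt (c : \bar R) : (limsup_within D xbar F < c)%E ->
  exists2 delta : R, 0 < delta &
    forall x, D x -> ball xbar delta x -> (F x < c)%E.
Proof.
move=> Lc; have [d [d0 sd]] : exists d : R, 0 < d /\ (s d < c)%E.
  apply: contrapT => /forallNP H; move: Lc; rewrite ltNge => /negP; apply.
  apply: lime_ge; first exact: limsup_within_cvg.
  near=> d; have d0 : 0 < d by near: d; exact: nbhs_right_gt.
  by rewrite leNgt; apply/negP => sd; exact: (H d).
exists d => // x Dx bx; apply: le_lt_trans sd.
by move: (lexx (s d)) => /(sP _ _ (s_ge0 _)); exact.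
Unshelve. all: by end_near. Qed.

End limsup_within_theory.

(** * Tangent directions and boundary points of sublevel sets *)

(** By convexity the whole segment from [y] to [y + t v] lies in the sublevel set, so the constant
    sequence [v] with steps [t / (n + 1)] witnesses tangency. *)
Lemma bouligand_sublevel (R : realType) (V : normedModType R) (f : V -> R)
    (y v : V) (t : R) :
  convex_fun f -> f y <= 0 -> 0 < t -> f (y + t *: v) <= 0 ->
  bouligand [set y | f y <= 0] y v.
Proof.
move=> cf fy t0 ft; exists (fun=> v), (fun n => t * harmonic n).
split; first exact: cvg_cst.
split.
  rewrite -[X in _ --> X](mulr0 t); apply: cvgM; first exact: cvg_cst.
  exact: cvg_harmonic.
have h0 n : 0 < harmonic n :> R by rewrite invr_gt0 ltr0n.
have h1 n : harmonic n <= 1 :> R by rewrite invf_le1 ?ltr0n// ler1n.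
split=> n; first by rewrite mulr_gt0.
have hn0 : 0 <= t * harmonic n by rewrite mulr_ge0 ?ltW.
have hn1 : t * harmonic n <= t by rewrite ger_pMr.
have /le_trans := convex_ray_le _ _ _ y v cf _ _ hn0 hn1 t0; apply.
have -> : t * harmonic n / t = harmonic n by rewrite mulrAC mulfV ?gt_eqF// mul1r.
have := h0 n; have := h1 n; nra.
Qed.

Lemma bd_sublevel_eq0 (R : realType) (T : topologicalType) (F : T -> R) (x : T) :
  continuous F -> bd [set x | F x <= 0] x -> F x = 0.
Proof.
move=> cF [clx nint].
have Fx : F x <= 0.
  have cl : closed [set x | F x <= 0].
    apply: (@closed_comp _ _ F [set r | r <= 0]); last exact: closed_le.
    by move=> z _; exact: cF.
  by rewrite closure_id in cl; rewrite -cl in clx.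
apply/eqP; rewrite eq_le Fx leNgt; apply/negP => Fx0; apply: nint.
by apply: filterS (cvgr_lt _ (cF x) _ Fx0) => z /ltW.
Qed.

(** * The two estimates relating error bound and excess *)

Section error_bound.
Variables (R : realType) (X : completeNormedModType R) (Y : normedModType R).
Variables (g : X -> Y) (f : Y -> R).
Hypotheses (cf : convex_fun f) (contf : continuous f).

Let S := [set x | f (g x) <= 0].
Let Sf := [set y | f y <= 0].
Let C x := [set h | dir_deriv f (g x) ('d g x h) <= 1].
Let T x := 'd g x @^-1` bouligand Sf (g x).

Lemma excess_le_error_bound (x : X) (K tau delta : R) :
  differentiable g x -> f (g x) = 0 -> 0 < K ->
  (forall v, exists2 h, `|h| <= K * `|v| & 'd g x h = v) ->
  0 < tau -> 0 < delta ->
  (forall z, `|z - x| < delta ->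
    (dist_set z S <= (tau * Num.max (f (g z)) 0)%:E)%E) ->
  (excess (C x) (T x) <= tau%:E)%E.
Proof.
move=> dg fgx K0 HK tau0 delta0 Heb; apply: excess_le.
  exists 0; apply: (dir_deriv_le _ _ _ _ _ cf _ _ ltr01) => t t0 _.
  by rewrite linear0 scaler0 addr0 subrr mul1r ltW.
move=> h Ch; apply/lee_addgt0Pr => th th0.
(* [e1] and [e2] make the final bound [rho + K * e2 * (nh + rho) <= tau + th]. *)
pose e1 := th / (4 * (tau + 1)).
have e10 : 0 < e1 by rewrite divr_gt0//; lra.
have e1E : (tau + 1) * e1 = th / 4 by rewrite /e1; field; lra.
have [l [r [l0 r0 Hl]]] := convex_locally_lipschitz _ _ f (g x) cf contf.
pose nh := `|h|; have nh0 : 0 <= nh by exact: normr_ge0.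
pose D := 4 * (tau * l * nh + K * (nh + tau + th) + 1).
have tl0 : 0 <= tau * l * nh by rewrite !mulr_ge0// ltW.
have kn0 : 0 <= K * (nh + tau + th) by rewrite mulr_ge0//; lra.
have D0 : 0 < D by rewrite /D; lra.
pose e2 := th / D.
have e20 : 0 < e2 by rewrite divr_gt0.
have e2E : e2 * D = th by rewrite /e2 divfK// gt_eqF.
(* [t * rho] bounds the distance from [x + t h] to [S]: the slope of [f] is at most [1 + e1],
   linearising [g] costs [l * e2 * nh], and the last [e1] makes the bound strict, so that a point of
   [S] realises it. *)
pose rho := tau * (1 + e1 + l * e2 * nh) + e1.
have e2tl0 := mulr_ge0 (ltW e20) tl0; have e2kn0 := mulr_ge0 (ltW e20) kn0.
have rhole : rho <= tau + th / 2 by rewrite /rho; rewrite /D in e2E; lra.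
have rho0 : 0 < rho by rewrite /rho; have := mulr_gt0 tau0 e10; lra.
have lt1 : dir_deriv f (g x) ('d g x h) < 1 + e1 by rewrite /C/= in Ch; lra.
have [d1 d10 Hd1] := dir_deriv_lt _ _ _ _ _ cf _ lt1.
have [d2 d20 Hd2] := differentiable_expansion _ _ _ _ _ _ dg e20.
pose nA := `|'d g x h|; have nA0 : 0 <= nA by exact: normr_ge0.
have e2n0 : 0 <= e2 * nh by rewrite mulr_ge0// ltW.
have nhr0 : 0 < nh + rho by lra.
have nh10 : 0 < nh + 1 by lra.
have nAe0 : 0 < nA + e2 * nh + 1 by lra.
near (0 : R)^'+ => t.
have t0 : 0 < t by near: t; exact: nbhs_right_gt.
have td1 : t < d1 by near: t; exact: nbhs_right_lt.
have td2 : t * (nh + rho) < d2.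
  by rewrite -ltr_pdivlMr//; near: t; apply: nbhs_right_lt; rewrite divr_gt0.
have tde : t * (nh + 1) < delta.
  by rewrite -ltr_pdivlMr//; near: t; apply: nbhs_right_lt; rewrite divr_gt0.
have tr : t * (nA + e2 * nh + 1) < r.
  by rewrite -ltr_pdivlMr//; near: t; apply: nbhs_right_lt; rewrite divr_gt0.
have nth : `|t *: h| = t * nh by rewrite normrZ gtr0_norm.
have hd2 : `|t *: h| < d2 by rewrite nth; have := mulr_gt0 t0 rho0; clear -td2; lra.
have := Hd2 _ hd2; rewrite nth linearZ/= => hexp.
have fle : f (g (x + t *: h)) <= t * (1 + e1 + l * e2 * nh).
  have h1 := Hd1 _ t0 td1; rewrite fgx subr0 in h1.
  have ntA : `|t *: 'd g x h| = t * nA by rewrite normrZ gtr0_norm.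
  have := Hl (g x + t *: 'd g x h) (g (x + t *: h)).
  rewrite (addrC (g x)) addrK ntA.
  have -> : g (x + t *: h) - (t *: 'd g x h + g x) = g (x + t *: h) - g x - t *: 'd g x h.
    by rewrite opprD addrA addrAC.
  have hh : `|g (x + t *: h) - g x| < r.
    have := ler_normD (g (x + t *: h) - g x - t *: 'd g x h) (t *: 'd g x h).
    rewrite subrK ntA; clear -hexp tr t0; lra.
  have tA : t * nA < r by have := mulr_ge0 (ltW t0) e2n0; clear -tr t0; lra.
  move=> /(_ tA hh).
  rewrite (addrC _ (g x)) => h2.
  have := ler_wpM2l (ltW l0) hexp; clear -h1 h2; lra.
have dlt : (dist_set (x + t *: h)%R S < (t * rho)%:E)%E.
  have hdel : `|x + t *: h - x| < delta by rewrite (addrC x) addrK nth; clear -fle tde t0; lra.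
  apply: (le_lt_trans (Heb _ hdel)); rewrite lte_fin.
  have M0 : 0 <= t * (1 + e1 + l * e2 * nh).
    rewrite mulr_ge0 ?ltW//; have := mulr_ge0 (mulr_ge0 (ltW l0) (ltW e20)) nh0.
    by clear -e10; lra.
  have : Num.max (f (g (x + t *: h))) 0 <= t * (1 + e1 + l * e2 * nh).
    by rewrite ge_max fle.
  move=> /(ler_wpM2l (ltW tau0)); rewrite /rho.
  by have := mulr_gt0 t0 e10; clear; lra.
have [z Sz xz] := dist_set_lt _ _ _ _ _ dlt.
have zx : `|z - x| < t * (nh + rho).
  have -> : z - x = t *: h - (x + t *: h - z).
    by rewrite opprB (opprD x) (addrA z) [RHS]addrC subrK.
  by apply: (le_lt_trans (ler_normB _ _)); rewrite nth; clear -xz; lra.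
have := Hd2 (z - x) (lt_trans zx td2); rewrite (addrC x) subrK.
set q := g z - g x - _ => qle.
(* The correction [e] absorbs the linearisation residual, so that ['d g x] maps [w] exactly to
   [(g z - g x) / t], a direction leading from [g x] into [Sf]. *)
have [e eK Ae] := HK (t^-1 *: q).
have tV0 : 0 < t^-1 by rewrite invr_gt0.
pose w := t^-1 *: (z - x) + e.
have Tw : T x w.
  apply: (bouligand_sublevel _ _ _ _ _ t) => //; first by rewrite fgx.
  rewrite /w linearD linearZ/= Ae -scalerDr scalerA mulfV ?gt_eqF// scale1r.
  by rewrite /q (addrC ('d g x _)) subrK subrKC.
apply: (le_trans (dist_set_le _ _ _ _ _ Tw)); rewrite -EFinD lee_fin.
have -> : h - w = t^-1 *: (x + t *: h - z) - e.
  rewrite /w opprD addrA; congr (_ - _).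
  have -> : x + t *: h - z = t *: h - (z - x) by rewrite (addrC x) -addrA opprB.
  by rewrite [RHS]scalerBr scalerA mulVf ?gt_eqF// scale1r.
apply: (le_trans (ler_normB _ _)).
have : `|t^-1 *: (x + t *: h - z)| <= rho.
  by rewrite normrZ gtr0_norm// ler_pdivrMl// ltW.
have : `|e| <= K * e2 * (nh + rho).
  apply: (le_trans eK); rewrite -mulrA ler_pM2l// normrZ gtr0_norm// ler_pdivrMl//.
  apply: (le_trans qle); rewrite mulrCA ler_pM2l// ltW//.
rewrite /D in e2E.
have : K * e2 * (nh + rho) <= K * e2 * (nh + tau + th).
  by rewrite ler_pM2l; [clear -rhole th0; lra|exact: mulr_gt0].
clear -th0 e2E e2tl0 e20 rhole; lra.
Unshelve. all: by end_near. Qed.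

(** Tangency gives points [g u + t v] of [Sf] with [v] near ['d g u w]. They are within a small
    multiple of [t] of [g (u + t w)], and metric regularity lifts them to points [z] of [S] near
    [u + t w]. *)
Lemma bouligand_approx (xbar u w : X) (kappa rho eps t0 : R) :
  differentiable g u -> 0 < kappa -> 0 < rho ->
  (forall x y, `|x - xbar| < rho -> `|y - g x| < rho ->
    forall theta, kappa * `|g x - y| < theta ->
    exists2 z, g z = y & `|x - z| < theta) ->
  `|u - xbar| < rho -> T u w -> 0 < eps -> 0 < t0 ->
  exists t z, [/\ 0 < t, t <= t0, S z & `|u + t *: w - z| < eps * t].
Proof.
move=> dg k0 rho0 Hreg urho [vs [ts [cvs [cts [ts0 Hts]]]]] eps0 t00.
pose nw := `|w|; have nw0 : 0 <= nw by exact: normr_ge0.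
have nw1 : 0 < nw + 1 by lra.
(* Linearisation and the error in [v] contribute [e * nw] and [e]. After multiplication by [kappa]
   they total [eps / 2], which leaves a strict margin. *)
pose e := eps / (2 * kappa * (nw + 1)).
have e0 : 0 < e by rewrite divr_gt0// !mulr_gt0.
have eE : kappa * (e * (nw + 1)) = eps / 2 by rewrite /e; field; rewrite !gt_eqF.
have [d d0 Hd] := differentiable_expansion _ _ _ _ _ _ dg e0.
have en0 : 0 < e * (nw + 1) by exact: mulr_gt0.
have tn t1 : 0 < t1 -> \forall n \near \oo, ts n < t1 by exact: cvgr_lt.
near \oo => n.
have vn : `|'d g u w - vs n| < e by near: n; exact: cvgr_dist_lt.
have t1 : ts n < t0 by near: n; exact: tn.
have t2 : ts n * (nw + 1) < d.
  by rewrite -ltr_pdivlMr//; near: n; apply: tn; rewrite divr_gt0.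
have t3 : ts n * (nw + 1) < rho - `|u - xbar|.
  by rewrite -ltr_pdivlMr//; near: n; apply: tn; rewrite divr_gt0// subr_gt0.
have t4 : ts n * (e * (nw + 1)) < rho.
  by rewrite -ltr_pdivlMr//; near: n; apply: tn; rewrite divr_gt0.
have := ts0 n; have := Hts n; move: t1 t2 t3 t4.
set t := ts n; set v := vs n in vn * => t1 t2 t3 t4 Hv tpos.
have ntw : `|t *: w| = t * nw by rewrite normrZ gtr0_norm.
have := Hd (t *: w); rewrite ntw linearZ/= => /(_ ltac:(lra)) hexp.
have hx : `|u + t *: w - xbar| < rho.
  by rewrite addrAC (le_lt_trans (ler_normD _ _))// ntw; lra.
have hy : `|g u + t *: v - g (u + t *: w)| <= t * (e * (nw + 1)).
  have -> : g u + t *: v - g (u + t *: w) =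
     - (g (u + t *: w) - g u - t *: 'd g u w) - t *: ('d g u w - v).
    by rewrite scalerBr !opprB [RHS]addrC subrKA [RHS]addrCA addrA.
  apply: (le_trans (ler_normB _ _)).
  rewrite normrN normrZ (gtr0_norm tpos).
  have := ler_wpM2l (ltW tpos) (ltW vn); lra.
have := Hreg _ _ hx (le_lt_trans hy t4) (eps * t).
rewrite distrC => /(_ _)[|z gz hz].
  apply: (le_lt_trans (ler_wpM2l (ltW k0) hy)).
  have := mulr_gt0 eps0 tpos; have := congr1 ( *%R t) eE; lra.
by exists t, z; split=> //; [exact: ltW|rewrite /S/= gz].
Unshelve. all: by end_near. Qed.

Lemma error_bound_of_excess (xbar : X) (kappa rho delta beta gamma : R) :
  cont_diff g -> f (g xbar) <= 0 -> 0 < kappa -> 0 < rho ->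
  (forall x y, `|x - xbar| < rho -> `|y - g x| < rho ->
    forall theta, kappa * `|g x - y| < theta ->
    exists2 z, g z = y & `|x - z| < theta) ->
  0 < delta -> 0 < beta -> beta < gamma ->
  (forall u, bd S u -> `|u - xbar| < delta ->
    (excess (C u) (T u) < beta%:E)%E) ->
  exists2 d : R, 0 < d & forall x, `|x - xbar| < d ->
    (dist_set x S <= (gamma * Num.max (f (g x)) 0)%:E)%E.
Proof.
move=> cdg fxbar k0 rho0 Hreg delta0 beta0 betag Hex.
have dg x : differentiable g x by case: cdg.
have cg : continuous g by move=> z; exact: differentiable_continuous.
have cfg : continuous (fun x => f (g x)).
  by move=> z; apply: (@cvg_comp _ _ _ g f); [exact: cg|exact: contf].
have [l [r [l0 r0 Hl]]] := convex_locally_lipschitz _ _ f (g xbar) cf contf.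
have [d1 /= d10 Hd1] := (nbhs_normP _ _).1 (cvgr_dist_lt _ _ (cg xbar) _ r0).
have bg0 : 0 < beta + 2 * gamma by lra.
(* [eta] solves [(1 + eta) * beta = (1 - 2 * eta) * gamma]. *)
pose eta := (gamma - beta) / (beta + 2 * gamma).
have etaE : eta * (beta + 2 * gamma) = gamma - beta by rewrite divfK// gt_eqF.
have eta0 : 0 < eta by rewrite divr_gt0//; lra.
have eta1 : eta < 1 / 2 by rewrite ltr_pdivrMr//; lra.
(* The linearisation error [l * eps * |h|], multiplied by [beta], becomes [eta / 2 * |h|]. *)
pose eps := eta / (2 * l * beta).
have epsE : 2 * (l * eps * beta) = eta.
  by rewrite /eps; field; rewrite !gt_eqF.
have eps0 : 0 < eps by rewrite divr_gt0// !mulr_gt0.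
have [d2 d20 Hd2] := strictly_differentiable _ _ _ _ xbar _ cdg eps0.
(* Halved because [u] is only known to lie within [2 * d] of [xbar]. *)
pose d := Num.min (Num.min d1 d2) (Num.min rho delta) / 2.
have d0 : 0 < d by rewrite divr_gt0// !lt_min d10 d20 rho0.
have [dd1 dd2 ddr ddd] : [/\ 2 * d <= d1, 2 * d <= d2, 2 * d <= rho & 2 * d <= delta].
  by rewrite /d (mulrC 2) divfK//; split; rewrite !ge_min lexx ?orbT.
exists d => // x xd.
have gam0 : 0 < gamma by lra.
have [fx0|fx0] := leP (f (g x)) 0.
  apply: (le_trans (dist_set_le _ _ x x _ _)) => //.
  by rewrite subrr normr0 mulr0.
have clS : closed S.
  apply: (@closed_comp _ _ (fun x => f (g x)) [set r | r <= 0]); last exact: closed_le.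
  by move=> z _; exact: cfg.
have [|//|u [Su ule umin]] := @ekeland R X S (fun z => `|x - z|) eta 0 xbar
  clS _ eta0 _ fxbar.
  by move=> z; apply: cvg_norm; apply: cvgB; [exact: cvg_cst|exact: cvg_id].
apply: (le_trans (dist_set_le _ _ x u _ Su)); rewrite lee_fin.
pose h := x - u; rewrite -/h in ule *.
have h0 : 0 < `|h|.
  rewrite normr_gt0 subr_eq0; apply/eqP => xu; move: fx0.
  by rewrite xu ltNge => /negP; apply.
have hd : `|h| < d by have := mulr_ge0 (ltW eta0) (normr_ge0 (u - xbar)); lra.
have ud : `|u - xbar| < 2 * d.
  have := ler_distD x u xbar; rewrite (distrC u x) -/h; lra.
(* If [u] were interior, a small step towards [x] would stay in [S] and shorten the distance to [x]
   by more than [eta] times its length. *)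
have bdu : bd S u.
  split; first exact: subset_closure.
  move=> /nbhs_normP[e /= e0 He].
  pose s := Num.min 1 (e / (2 * `|h|)).
  have s0 : 0 < s by rewrite lt_min ltr01 divr_gt0// mulr_gt0.
  have s1 : s <= 1 by rewrite ge_min lexx.
  have se : s <= e / (2 * `|h|) by rewrite ge_min lexx orbT.
  rewrite ler_pdivlMr ?mulr_gt0// in se.
  have Ss : S (u + s *: h).
    apply: He; rewrite /ball_/= opprD addrA subrr sub0r normrN normrZ gtr0_norm//; lra.
  have := umin _ Ss; rewrite opprD addrA -/h (addrC u) addrK.
  have -> : h - s *: h = (1 - s) *: h by rewrite scalerBl scale1r.
  rewrite !normrZ (gtr0_norm s0) ger0_norm ?subr_ge0//.
  have := mulr_gt0 s0 h0; nra.
have fgu : f (g u) = 0 by exact: (bd_sublevel_eq0 _ _ _ _ cfg bdu).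
pose c := f (g x) + l * eps * `|h|.
have c0 : 0 < c by rewrite /c; have := mulr_gt0 (mulr_gt0 l0 eps0) h0; lra.
have cV0 : 0 < c^-1 by rewrite invr_gt0.
have gr z : `|z - xbar| < 2 * d -> `|g z - g xbar| < r.
  move=> zd; rewrite distrC; apply: Hd1; rewrite /ball_/= distrC; lra.
have gur := gr _ ud.
(* The ray along ['d g u h] is compared with the segment from [g u] to [g x]. There convexity and
   [f (g u) = 0] give the bound [t * f (g x)], and strict differentiability with the Lipschitz bound
   controls the difference. *)
have slope : exists2 t0 : R, 0 < t0 & forall t, 0 < t -> t < t0 ->
    f (g u + t *: 'd g u h) <= t * c.
  pose k1 := `|'d g u h|; pose k2 := `|g x - g u|.
  have k10 : 0 <= k1 by exact: normr_ge0.
  have k20 : 0 <= k2 by exact: normr_ge0.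
  have k0' : 0 < k1 + k2 + 1 by clear -k10 k20; lra.
  exists (Num.min 1 ((r - `|g u - g xbar|) / (k1 + k2 + 1))).
    by rewrite lt_min ltr01 divr_gt0// subr_gt0.
  move=> t t0; rewrite lt_min ltr_pdivlMr// => /andP[t1 tr].
  have tk1 := mulr_ge0 (ltW t0) k10; have tk2 := mulr_ge0 (ltW t0) k20.
  have near_gu k : t * `|k| < r - `|g u - g xbar| -> `|g u + t *: k - g xbar| < r.
    move=> tk; rewrite addrAC; apply: (le_lt_trans (ler_normD _ _)).
    rewrite normrZ gtr0_norm//; clear -tk; lra.
  have := Hl _ _ (near_gu (g x - g u) ltac:(rewrite -/k2; clear -tr t0 tk1; lra))
    (near_gu ('d g u h) ltac:(rewrite -/k1; clear -tr t0 tk2; lra)).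
  have -> : g u + t *: 'd g u h - (g u + t *: (g x - g u)) =
      - (t *: (g x - g u - 'd g u h)).
    rewrite opprD addrACA subrr add0r -(scalerBr t ('d g u h)) -scalerN.
    by congr (_ *: _); rewrite [RHS]opprB.
  rewrite normrN normrZ (gtr0_norm t0) => h1.
  have h2 : `|g x - g u - 'd g u h| <= eps * `|h|.
    by apply: Hd2; clear -ud xd d0 dd2; lra.
  have := convex_ray_le _ _ _ (g u) (g x - g u) cf _ _ (ltW t0) (ltW t1) ltr01.
  rewrite scale1r subrKC divr1 fgu mulr0 addr0 => h3.
  have := ler_wpM2l (mulr_ge0 (ltW l0) (ltW t0)) h2; rewrite /c; clear -h1 h3; lra.
have Ch : C u (c^-1 *: h).
  have [t0 t00 Ht] := slope.
  apply: (dir_deriv_le _ _ _ _ _ cf _ (t0 * c)); first by rewrite mulr_gt0.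
  move=> t tpos tt0; rewrite linearZ/= scalerA fgu subr0 mul1r.
  have := Ht (t / c); rewrite divfK ?gt_eqF//; apply; first by rewrite divr_gt0.
  by rewrite ltr_pdivrMr.
have /dist_set_lt[w Tw hw] : (dist_set (c^-1 *: h)%R (T u) < beta%:E)%E.
  by apply: (le_lt_trans (dist_set_le_excess _ _ _ _ _ Ch)); apply: Hex => //; clear -ud ddd; lra.
set b := `|_| in hw.
have e0 : 0 < (beta - b) / 2 by clear -hw; lra.
have urho : `|u - xbar| < rho by clear -ud ddr; lra.
have [t [z [t0 tc Sz uz]]] :=
  bouligand_approx _ _ _ _ _ _ _ (dg u) k0 rho0 Hreg urho Tw e0 c0.
have hz := umin _ Sz.
(* Since [u + t w = u + s (c w)] and [c w] is at distance [c * b] from [h], the point [z] has nearly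
   advanced a fraction [s] of the way to [x]. *)
pose s := t / c.
have s0 : 0 < s by rewrite divr_gt0.
have s1 : s <= 1 by rewrite ler_pdivrMr// mul1r.
have tE : t = s * c by rewrite /s divfK// gt_eqF.
have cb : `|h - c *: w| = c * b.
  rewrite /b -{2}(gtr0_norm c0) -normrZ scalerBr scalerA mulfV ?gt_eqF//.
  by rewrite scale1r.
have xz : `|x - z| <= (1 - s) * `|h| + s * (c * b) + (beta - b) / 2 * t.
  have -> : x - z = (1 - s) *: h + s *: (h - c *: w) + (u + t *: w - z).
    rewrite scalerBl scale1r (scalerBr s h) scalerA -tE subrKA (addrC u).
    by rewrite -(addrA (t *: w)) subrKA /h subrKA.
  apply: (le_trans (ler_normD _ _)); apply: lerD; last exact: ltW.
  apply: (le_trans (ler_normD _ _)).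
  rewrite (normrZ (1 - s) h) (normrZ s (h - _)) (gtr0_norm s0).
  by rewrite ger0_norm ?subr_ge0// cb.
have zu : `|z - u| <= t * `|w| + (beta - b) / 2 * t.
  have -> : z - u = t *: w - (u + t *: w - z).
    by rewrite opprB (opprD u) (addrA z) [RHS]addrC subrK.
  apply: (le_trans (ler_normB _ _)); rewrite normrZ (gtr0_norm t0).
  by rewrite lerD2l ltW.
have cw : c * `|w| <= `|h| + c * b.
  rewrite -{1}(gtr0_norm c0) -normrZ -cb.
  have := ler_normB h (h - c *: w); by rewrite opprB subrKC.
(* This is Ekeland's inequality at [z], divided by [s]; the margins [(beta - b) / 2] are absorbed by
   replacing [b] with [beta]. *)
have key : `|h| <= c * beta + eta * (`|h| + c * beta).
  rewrite -(ler_pM2l s0); rewrite tE in xz zu.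
  have k1 := ler_wpM2l (ltW (mulr_gt0 s0 eta0)) cw.
  have k2 := ler_wpM2l (ltW eta0) zu.
  have k3 : 0 <= s * c * (beta - b) by rewrite mulr_ge0 ?ltW ?mulr_gt0 ?subr_gt0.
  have k4 := mulr_ge0 (ltW eta0) k3.
  rewrite -/h in hz; clear -k1 k2 k3 k4 hz xz; lra.
(* Inserting [c] leaves [|h|] with a coefficient of at least [1 - 2 * eta] on the left, because
   [eta < 1]. The choice of [eta] then turns [(1 + eta) * beta] into [(1 - 2 * eta) * gamma]. *)
have : (1 - 2 * eta) * `|h| <= (1 - 2 * eta) * (gamma * f (g x)).
  have k1 := congr1 ( *%R^~ `|h|) epsE.
  have k2 := congr1 ( *%R eta) k1.
  have k3 := congr1 ( *%R^~ (f (g x))) etaE.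
  have k4 : 0 <= eta * (1 - eta) * `|h|.
    by apply: mulr_ge0 => //; apply: mulr_ge0; clear -k3 eta0 eta1; lra.
  rewrite /c in key; clear -k1 k2 k3 k4 key; lra.
rewrite ler_pM2l; last by clear -key eta1; lra.
by move/le_trans; apply; rewrite ler_pM2l// le_max lexx.
Qed.

End error_bound.

(** * The modulus as a limit superior *)

Theorem theorem4p5 (R : realType) (X Y : completeNormedModType R)
  (g : X -> Y) (f : Y -> R) (xbar : X) :
  cont_diff g -> convex_fun f -> continuous f ->
  [set x | f (g x) <= 0] xbar ->
  metrically_regular g xbar ->
  let Sf := [set y | f y <= 0] in
  let S := [set x | f (g x) <= 0] in
  let L := limsup_within (bd S) xbar
      (fun x => excess [set h | dir_deriv f (g x) ('d g x h) <= 1]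
                       ('d g x @^-1` bouligand Sf (g x))) in
  (local_error_bound f g xbar <-> (L < +oo)%E) /\ eb_modulus f g xbar = L.
Proof.
move=> cdg cf contf Sxbar mr Sf S L.
have dg x : differentiable g x by case: cdg.
have cg : continuous g by move=> z; exact: differentiable_continuous.
have cfg : continuous (fun x => f (g x)).
  by move=> z; apply: (@cvg_comp _ _ _ g f); [exact: cg|exact: contf].
have [kappa [rho [k0 rho0 Hreg]]] := metrically_regularP _ _ _ _ _ cg mr.
have L_ge0 : (0 <= L)%E by apply: limsup_within_ge0 => x; exact: excess_ge0.
have L_le : (L <= eb_modulus f g xbar)%E.
  apply: le_ereal_inf_tmp => _ [tau [tau0 [delta [delta0 Heb]]] <-].
  have m0 : 0 < Num.min rho delta by rewrite lt_min rho0.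
  apply: (limsup_within_le _ _ _ _ _ _ _ _ m0).
  - by move=> x; exact: excess_ge0.
  - by rewrite lee_fin ltW.
  move=> x bdx; rewrite -ball_normE/= distrC lt_min => /andP[xrho xdelta].
  have K0 : 0 < 4 * (kappa + 1) by rewrite mulr_gt0//; lra.
  have xd0 : 0 < delta - `|x - xbar| by rewrite subr_gt0.
  apply: (excess_le_error_bound _ _ _ _ _ cf contf x _ _ _ (dg x) _ K0 _ tau0 xd0).
  - exact: (bd_sublevel_eq0 _ _ _ _ cfg bdx).
  - apply: (metrically_regular_onto _ _ _ _ _ _ _ (dg x) k0 rho0) => y yx.
    exact: Hreg.
  move=> z zx; apply: Heb; rewrite -ball_normE/= distrC.
  have := ler_distD x z xbar; lra.
(* A midpoint [beta] between [L] and [gamma] strictly bounds the excess near [xbar] and leaves the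
   gap that the upper estimate needs. *)
have eb_of_gt (gamma : R) : (L < gamma%:E)%E -> eb_consts f g xbar gamma.
  move=> Lg; have Lfin : L \is a fin_num.
    by rewrite ge0_fin_numE// (lt_trans Lg) ?ltry.
  have LE : L = (fine L)%:E by rewrite fineK.
  have l0 : 0 <= fine L by rewrite fine_ge0.
  rewrite LE lte_fin in Lg.
  pose beta := (fine L + gamma) / 2.
  have Lb : (L < beta%:E)%E by rewrite LE lte_fin /beta; lra.
  have [delta delta0 Hex] :=
    limsup_within_lt _ _ _ _ _ (fun x => excess_ge0 _ _ _ _) _ Lb.
  have b0 : 0 < beta by rewrite /beta; lra.
  have bg : beta < gamma by rewrite /beta; lra.
  have [|d d0 Hd] := error_bound_of_excess _ _ _ _ _ cf contf _ _ _ _ _ _ cdg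
    Sxbar k0 rho0 Hreg delta0 b0 bg.
    by move=> u bdu ud; apply: Hex => //; rewrite -ball_normE/= distrC.
  split; first lra.
  exists d; split=> // x; rewrite -ball_normE/= distrC; exact: Hd.
have modE : eb_modulus f g xbar = L.
  apply/eqP; rewrite eq_le L_le andbT.
  have [Lfin|] := ltP L +oo%E; last by rewrite leye_eq => /eqP->; rewrite leey.
  have LE : L = (fine L)%:E by rewrite fineK// ge0_fin_numE.
  apply/lee_addgt0Pr => e e0; apply: ereal_inf_lbound.
  exists (fine L + e); last by rewrite EFinD -LE.
  by apply: eb_of_gt; rewrite {1}LE lte_fin; lra.
(* The infimum of the empty set is [+oo], so the modulus is finite exactly when an admissible
   constant exists. *)
split=> //; rewrite -modE; split.
  move=> [tau Htau]; apply: (le_lt_trans _ (ltry tau)).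
  by apply: ereal_inf_lbound; exists tau.
by move=> /ereal_inf_lt[_ [tau Htau _] _]; exists tau.
Qed.
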